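(* Let $f\in C_c^2(S^2;D_1)$, and let $\gamma_1,\dots,\gamma_m$ be the branch directions of the star transform $\mathcal{S}$ (with weights $c_1,\dots,c_m$). Then for any $\xi\in\mathbb{S}^1\setminus(\mathcal{Z}_1\cup\mathcal{Z}_2)$ and any $s\in\mathbb{R}$, $$\left[\mathcal{Q}(\xi)\right]^{-1}\frac{d}{ds}\mathcal{R}(\mathcal{S}f)(\xi,s)=\mathcal{R}f(\xi,s),$$ where $\mathcal{R}$ denotes the component-wise Radon transform.
   Context: $D_1\subset\mathbb{R}^2$ is an open disc centered at the origin; $C_c^2(S^2;D_1)$ is the space of symmetric $2$-tensor fields on $\mathbb{R}^2$ with twice continuously differentiable components compactly supported in $D_1$. A symmetric $2$-tensor $g=(g_{ij})$ is identified with the (column) vector $(g_{11},g_{12},g_{22})\in\mathbb{R}^3$; under this identification, for $a=(a_1,a_2)$ and $a^\perp=(-a_2,a_1)$: $a^2=(a_1^2,a_1a_2,a_2^2)$, $a\odot a^\perp=(-a_1a_2,\frac12(a_1^2-a_2^2),a_1a_2)$, $(a^\perp)^2=(a_2^2,-a_1a_2,a_1^2)$. The dot denotes the Euclidean dot product in $\mathbb{R}^3$ (for such vectors) or in $\mathbb{R}^2$. For a unit vector $a$, $\mathcal{X}_a h(x)=\int_0^\infty h(x+ta)\,dt$. Let $\gamma_1,\dots,\gamma_m$ be distinct unit vectors in $\mathbb{R}^2$ and $c_1,\dots,c_m$ non-zero real constants. The star transform of $f$ is the $\mathbb{R}^3$-valued function on $\mathbb{R}^2$ $$\mathcal{S}f=\sum_{i=1}^m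 c_i\,\mathcal{X}_{\gamma_i}\begin{bmatrix} f\cdot\gamma_i^2\\ f\cdot(\gamma_i\odot\gamma_i^\perp)\\ f\cdot(\gamma_i^\perp)^2\end{bmatrix}.$$ Let $\mathcal{Z}_1=\bigcup_{i=1}^m\{\xi\in\mathbb{S}^1:\xi\cdot\gamma_i=0\}$. For $\xi\in\mathbb{S}^1\setminus\mathcal{Z}_1$ define vectors in $\mathbb{R}^3$ $$\gamma(\xi)=-\sum_{i=1}^m\frac{c_i\gamma_i^2}{\xi\cdot\gamma_i},\quad \gamma^\dag(\xi)=-\sum_{i=1}^m\frac{c_i\,\gamma_i\odot\gamma_i^\perp}{\xi\cdot\gamma_i},\quad \gamma^\perp(\xi)=-\sum_{i=1}^m\frac{c_i(\gamma_i^\perp)^2}{\xi\cdot\gamma_i},$$ let $\mathcal{Q}(\xi)$ be the $3\times3$ matrix with rows $\gamma(\xi),\gamma^\dag(\xi),\gamma^\perp(\xi)$ (in this order), and let $$\mathcal{Z}_2=\{\xi\in\mathbb{S}^1\setminus\mathcal{Z}_1:\gamma^\dag(\xi)=0\}\cup\Big\{\xi\in\mathbb{S}^1\setminus\mathcal{Z}_1:\sum_{i=1}^m\frac{c_i}{\xi\cdot\gamma_i}=0\Big\}.$$ For a scalar function $h$, $\mathcal{R}h(\xi,s)$ is the integral of $h$ (with respect to arc length) over the line $\{x\in\mathbb{R}^2:x\cdot\xi=s\}$. *)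

(* Defs.v *)
From HB Require Import structures.
From mathcomp Require Import all_boot all_order all_algebra.
From mathcomp Require Import all_classical all_reals all_analysis.
From mathcomp Require Import ring.

Set Implicit Arguments.
Unset Strict Implicit.
Unset Printing Implicit Defensive.

Import Order.TTheory GRing.Theory Num.Theory.
Import numFieldNormedType.Exports.

Local Open Scope classical_set_scope.
Local Open Scope ring_scope.

Section Euclidean.
Context {R : realType}.

Definition dotp n (u v : 'cV[R]_n) : R := \sum_(i < n) u i 0 * v i 0.

(* The library norm on matrices is the sup norm, hence a separate name. *)
Definition enorm n (u : 'cV[R]_n) : R := Num.sqrt (dotp u u).

Definition unit_circle : set 'cV[R]_2 := [set x | enorm x = 1].

Definition disc (r : R) : set 'cV[R]_2 := [set x | enorm x < r].

Definition vec2 (a b : R) : 'cV[R]_2 := \col_(k < 2) [:: a; b]`_k.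

Definition vec3 (a b c : R) : 'cV[R]_3 := \col_(k < 3) [:: a; b; c]`_k.

Definition rot (a : 'cV[R]_2) : 'cV[R]_2 := vec2 (- a 1 0) (a 0 0).

End Euclidean.

Section Tensors.
Context {R : realType}.

Definition tvec (g : 'M[R]_2) : 'cV[R]_3 := vec3 (g 0 0) (g 0 1) (g 1 1).

Definition symprod (a b : 'cV[R]_2) : 'M[R]_2 :=
  2^-1 *: (a *m b^T + b *m a^T).

Definition sq (a : 'cV[R]_2) : 'cV[R]_3 := tvec (symprod a a).
Definition odot_rot (a : 'cV[R]_2) : 'cV[R]_3 := tvec (symprod a (rot a)).
Definition sq_rot (a : 'cV[R]_2) : 'cV[R]_3 := tvec (symprod (rot a) (rot a)).

Lemma sqE a : sq a = vec3 (a 0 0 ^+ 2) (a 0 0 * a 1 0) (a 1 0 ^+ 2).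
Proof.
by congr vec3; rewrite !(mxE, big_ord1); field.
Qed.

Lemma odot_rotE a : odot_rot a =
  vec3 (- (a 0 0 * a 1 0)) (2^-1 * (a 0 0 ^+ 2 - a 1 0 ^+ 2)) (a 0 0 * a 1 0).
Proof.
by congr vec3; rewrite !(mxE, big_ord1) /=; field.
Qed.

Lemma sq_rotE a :
  sq_rot a = vec3 (a 1 0 ^+ 2) (- (a 0 0 * a 1 0)) (a 0 0 ^+ 2).
Proof.
by congr vec3; rewrite !(mxE, big_ord1) /=; field.
Qed.

End Tensors.

Section Regularity.
Context {R : realType}.

Fixpoint Ck (k : nat) (h : 'cV[R]_2 -> R) : Prop :=
  if k is k'.+1 then
    continuous h /\
    forall j : 'I_2,
      (forall x, derivable h x (delta_mx j 0)) /\
      Ck k' (fun x => 'D_(delta_mx j 0) h x)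
  else continuous h.

Definition C2c_sym (r : R) (f : 'cV[R]_2 -> 'M[R]_2) : Prop :=
  [/\ forall x, (f x)^T = f x,
      forall i j, Ck 2 (fun x => f x i j),
      compact (closure [set x | f x != 0]) &
      closure [set x | f x != 0] `<=` disc r].

End Regularity.

Section Transforms.
Context {R : realType}.

Definition ray_transform (a : 'cV[R]_2) (h : 'cV[R]_2 -> R) (x : 'cV[R]_2) : R :=
  \int[lebesgue_measure]_(t in `[0, +oo[) h (x + t *: a).

(* For a unit vector xi, t |-> line xi s t is the arc-length parametrization
   of the line of all x with dotp x xi = s. *)
Definition line (xi : 'cV[R]_2) (s t : R) : 'cV[R]_2 := s *: xi + t *: rot xi.

Definition radon_converges (h : 'cV[R]_2 -> R) (xi : 'cV[R]_2) (s : R) : Prop :=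
  lebesgue_measure.-integrable [set: R] (fun t => (h (line xi s t))%:E).

Definition radon (h : 'cV[R]_2 -> R) (xi : 'cV[R]_2) (s : R) : R :=
  \int[lebesgue_measure]_(t in [set: R]) h (line xi s t).

Definition vray_transform (a : 'cV[R]_2) n (F : 'cV[R]_2 -> 'cV[R]_n)
    (x : 'cV[R]_2) : 'cV[R]_n :=
  \col_k ray_transform a (fun y => F y k 0) x.

Definition vradon n (F : 'cV[R]_2 -> 'cV[R]_n) (xi : 'cV[R]_2) (s : R) :
    'cV[R]_n :=
  \col_k radon (fun y => F y k 0) xi s.

End Transforms.

Section StarTransform.
Context {R : realType} (m : nat).
Variables (gamma : 'I_m -> 'cV[R]_2) (c : 'I_m -> R).

Definition star (f : 'cV[R]_2 -> 'M[R]_2) (x : 'cV[R]_2) : 'cV[R]_3 :=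
  \sum_(i < m) c i *: vray_transform (gamma i)
    (fun y => vec3 (dotp (tvec (f y)) (sq (gamma i)))
                   (dotp (tvec (f y)) (odot_rot (gamma i)))
                   (dotp (tvec (f y)) (sq_rot (gamma i)))) x.

Definition Z1 : set 'cV[R]_2 :=
  \bigcup_(i in [set: 'I_m]) [set xi | unit_circle xi /\ dotp xi (gamma i) = 0].

Definition gamma_par (xi : 'cV[R]_2) : 'cV[R]_3 :=
  - \sum_(i < m) (c i / dotp xi (gamma i)) *: sq (gamma i).

Definition gamma_dag (xi : 'cV[R]_2) : 'cV[R]_3 :=
  - \sum_(i < m) (c i / dotp xi (gamma i)) *: odot_rot (gamma i).

Definition gamma_perp (xi : 'cV[R]_2) : 'cV[R]_3 :=
  - \sum_(i < m) (c i / dotp xi (gamma i)) *: sq_rot (gamma i).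

Definition Qmx (xi : 'cV[R]_2) : 'M[R]_3 :=
  \matrix_(k < 3) ([:: gamma_par xi; gamma_dag xi; gamma_perp xi]`_k)^T.

Definition Z2 : set 'cV[R]_2 :=
  [set xi | (unit_circle `\` Z1) xi /\ gamma_dag xi = 0] `|`
  [set xi | (unit_circle `\` Z1) xi /\
            \sum_(i < m) c i / dotp xi (gamma i) = 0].

End StarTransform.

(* Main.v *)
Require Import Defs.
From HB Require Import structures.
From mathcomp Require Import all_boot all_order all_algebra.
From mathcomp Require Import all_classical all_reals all_analysis.
From mathcomp Require Import measurable_realfun.
From mathcomp Require Import ring lra.

Set Implicit Arguments.
Unset Strict Implicit.
Unset Printing Implicit Defensive.

Import Order.TTheory GRing.Theory Num.Theory.
Import numFieldNormedType.Exports.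

Local Open Scope classical_set_scope.
Local Open Scope ring_scope.

(** For a single branch of direction [a], the derivative in [s] of the Radon
    transform undoes the integration along the branch.  Fix a unit vector [xi]
    and let [phi p = R h (xi, p)] be the integral of a continuous compactly supported
    scalar [h] over the line at signed distance [p].  Integrating the ray
    transform of [h] over the line at distance [s] means sweeping the half-plane
    on one side of it by parallel rays; after exchanging the two integrals, the
    points at ray parameter [x] form the line at distance [s + x * k], with
    [k = xi . a], merely translated along itself.  Hence
    [R (X_a h) (xi, s)] is the integral of [phi (s + x * k)] over [x >= 0], that
    is [(K - U s) / k] with [U] a primitive of [phi] and [K] independent of [s],
    and its derivative is [- phi s / k].  The exchange is
    [oblique_rays_integral], the one-variable computation is
    [integral_halfline_comp], and together they give [is_derive_radon_ray].

    The three components of the star transform pair the tensor on branch [i]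
    with the vectors whose sums with weights [- c_i / (xi . gamma_i)] are the
    rows of [Q], so the derivative of [R (S f)] is [Q (xi) R f]
    ([is_derive_radon_star]).

    It remains to see that [Q] is invertible.  Put
    [C = - sum_i c_i / (xi . gamma_i)].  Since the directions have norm 1, the
    first and third rows add up to [C (1, 0, 1)]; their half difference has the
    form [(D, P, - D)], and the second row, [gamma_dag], is then [(- P, D, P)].
    Hence the determinant is [2 C (P ^ 2 + D ^ 2)] ([det_Qmx]), and the two
    parts of [Z2] are exactly the vanishing of [P ^ 2 + D ^ 2] and of [C]. *)

(** * Primitives of compactly supported continuous functions *)

Section CompactlySupported.
Context {R : realType}.
Notation mu := (@lebesgue_measure R).
Implicit Types (u : R -> R) (r a b c s x : R).

Definition primitive u x : R := \int[mu]_(t in `]-oo, x]) u t.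

Lemma csupp_continuous_integrable u r : continuous u ->
  (forall x, r <= `|x| -> u x = 0) -> mu.-integrable [set: R] (EFin \o u).
Proof.
move=> cu u0.
have : mu.-integrable `[- r, r] (EFin \o u).
  apply: continuous_compact_integrable; first exact: segment_compact.
  exact: continuous_subspaceT.
rewrite integrable_mkcond//= (restrict_EFin u) => iu.
suff -> : u = u \_ `[- r, r] by [].
apply/funext => x; rewrite patchE.
case: ifPn => // /negP xr; rewrite u0//.
rewrite leNgt; apply: contra_notN xr => xr; rewrite inE/= in_itv/=.
by rewrite -ler_norml ltW.
Qed.

Section primitive.
Variables (u : R -> R) (r : R).
Hypothesis cu : continuous u.
Hypothesis u0 : forall x, r <= `|x| -> u x = 0.
Let U := primitive u.

Let iu D : measurable D -> mu.-integrable D (EFin \o u).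
Proof.
by move=> mD; apply: integrableS (csupp_continuous_integrable cu u0).
Qed.

Lemma is_derive_primitive x : is_derive x 1 U (u x).
Proof.
have xx : x < x + 1 by rewrite ltrDl.
have [] := @continuous_FTC1 R u -oo%O x (x + 1) xx (iu (measurable_itv _))
  (ltNyr _) (@cu x).
by move=> dU; rewrite derive1E => U'; exact: DeriveDef dU U'.
Qed.

Lemma primitive_eq0 x : x <= - r -> U x = 0.
Proof.
move=> xr; rewrite /U /primitive (@eq_Rintegral _ _ _ mu _ (cst 0)); last first.
  move=> t; rewrite inE/= in_itv/= => tx; rewrite u0//.
  rewrite lerNr in xr; apply: (le_trans xr); rewrite -normrN.
  by apply: le_trans (ler_norm _); rewrite lerN2.
by rewrite /Rintegral integral0.
Qed.

Lemma primitive_eq_integral x : r <= x -> U x = \int[mu]_t u t.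
Proof.
move=> xr; rewrite /U /primitive Rintegral_mkcond; congr (Rintegral _ _).
apply/funext => t; rewrite patchE; case: ifPn => // /negP tx.
rewrite u0//; apply: (le_trans xr); apply: le_trans (ler_norm t).
by apply/ltW; rewrite ltNge; apply: contra_notN tx => tx; rewrite inE/= in_itv.
Qed.

(** [U (c + t * k) / k] is a primitive of [u (c + t * k)]. *)
Lemma integral_affine_comp a b c k : k != 0 -> a < b ->
  \int[mu]_(t in `[a, b]) u (c + t * k) = (U (c + b * k) - U (c + a * k)) / k.
Proof.
move=> k0 ab.
pose W t := k^-1 * U (c + t * k).
have dW (t : R) : is_derive t 1 W (u (c + t * k)).
  have dU := is_derive_primitive (c + t * k).
  have dc : is_derive t 1 (fun t => c + t * k) k.
    by apply: is_derive_eq; rewrite scaler0 !add0r mul1r /GRing.scale/= mulr1.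
  have dUc := @is_derive1_comp _ U (fun t => c + t * k) t _ _ dU dc.
  have := @is_deriveZ _ _ _ _ k^-1 t 1 _ dUc.
  by move/is_derive_eq; apply; rewrite /GRing.scale/= mulrCA mulVf// mulr1.
have cW : continuous W.
  by move=> t; apply/differentiable_continuous/derivable1_diffP.
rewrite /Rintegral (@continuous_FTC2 _ _ W)//.
- by rewrite -EFinB/= /W -mulrBr mulrC.
- apply: continuous_subspaceT => t; apply: continuous_comp; last exact: cu.
  by apply: cvgD; [exact: cvg_cst|apply: cvgM; [exact: cvg_id|exact: cvg_cst]].
- split.
  + by move=> t _; apply: ex_derive.
  + exact/cvg_at_right_filter/cW.
  + exact/cvg_at_left_filter/cW.
- by move=> t _; rewrite derive1E; apply: derive_val.
Qed.

(** Beyond a bound [T] the integrand vanishes and [s + T * k] has left the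
    support, to the right if [k] is positive and to the left otherwise; the
    value of [U] there is then a constant, so [s] enters only through [U s]. *)
Lemma integral_halfline_comp s k : k != 0 ->
  \int[mu]_(t in `[0, +oo[) u (s + t * k) =
  ((if 0 < k then \int[mu]_t u t else 0) - U s) / k.
Proof.
move=> k0; pose T := (`|r| + `|s|) / `|k| + 1.
have nk0 : 0 < `|k| by rewrite normr_gt0.
have T0 : 0 < T by rewrite ltr_wpDl// divr_ge0// addr_ge0.
have Tk : `|r| + `|s| <= T * `|k|.
  by rewrite mulrDl divfK ?gt_eqF// mul1r lerDl ltW.
have rr : r <= `|r| by exact: ler_norm.
have ns := ler_norm s; have nns := ler_norm (- s); rewrite normrN in nns.
(* Since [T * `|k|] is at least [`|r| + `|s|], every [t] past [T] has
   [`|s + t * k|] at least [r]. *)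
transitivity (\int[mu]_(t in `[0, T]) u (s + t * k)).
  rewrite Rintegral_mkcond [RHS]Rintegral_mkcond; congr Rintegral.
  apply/funext => t; rewrite !patchE !mem_setE !in_itv/= andbT.
  have [t0/=|_//=] := leP 0 t; have [//|Tt] := leP t T.
  rewrite u0//; have : T * `|k| <= `|t * k|.
    by rewrite normrM ler_wpM2r// (le_trans (ltW Tt))// ler_norm.
  rewrite -[s + _]addrC -[in X in _ -> X](opprK s) => tk.
  by apply: le_trans (lerB_dist _ _); rewrite normrN; lra.
rewrite integral_affine_comp// mul0r addr0; congr ((_ - _) / _).
have [k_gt0|k_le0] := ltP 0 k.
  by rewrite primitive_eq_integral//; rewrite (gtr0_norm k_gt0) in Tk; lra.
by rewrite primitive_eq0//; rewrite (ler0_norm k_le0) in Tk; lra.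
Qed.

Lemma integral_translation c : \int[mu]_t u (t + c) = \int[mu]_t u t.
Proof.
pose T := `|r| + `|c| + 1.
have T0 : 0 < T by rewrite ltr_wpDl// addr_ge0.
have rr : r <= `|r| by exact: ler_norm.
have nc := ler_norm c; have nnc := ler_norm (- c); rewrite normrN in nnc.
transitivity (\int[mu]_(t in `[- T, T]) u (c + t * 1)).
  rewrite [RHS]Rintegral_mkcond; congr Rintegral; apply/funext => t.
  rewrite !patchE !mem_setE !in_itv/= -ler_norml mulr1 (addrC c).
  have [//|Tt] := leP `|t| T; rewrite u0//.
  rewrite -(opprK c); apply: le_trans (lerB_dist _ _).
  by rewrite normrN; rewrite /T in Tt; lra.
rewrite integral_affine_comp// ?oner_neq0//; last by lra.
by rewrite !mulr1 divr1 primitive_eq_integral ?primitive_eq0 ?subr0// /T; lra.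
Qed.

End primitive.
End CompactlySupported.

(** * Integration over the plane *)

Section Plane.
Context {R : realType}.
Notation mu := (@lebesgue_measure R).
Let T := measurableTypeR R.

(** The square balls with rational centres and radii [1 / n] are countably many,
    they are measurable rectangles, and those contained in an open set cover
    it. *)
Lemma open_measurable_plane (U : set (R * R)) : open U ->
  @measurable _ (T * T)%type U.
Proof.
move=> oU.
pose B (q : rat * rat * nat) : set (T * T) :=
  ball (ratr q.1.1 : R) q.2.+1%:R^-1 `*` ball (ratr q.1.2 : R) q.2.+1%:R^-1.
have -> : U = \bigcup_(q in [set q | B q `<=` U]) B q.
  apply/seteqP; split => [[x y] Uxy|z [q qU]]; last exact: qU.
  have /nbhs_ballP[e /= e0 eU] : nbhs (x, y) U by exact: open_nbhs_nbhs.
  have [n ne] : exists n : nat, n.+1%:R^-1 < e / 2.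
    have e20 : 0 < e / 2 by rewrite divr_gt0.
    near \oo => n; exists n; near: n.
    exact: (near_infty_natSinv_lt (PosNum e20)).
  have n0 : 0 < n.+1%:R^-1 :> R by rewrite invr_gt0.
  have rat_near (a : R) : exists p : rat, `|ratr p - a| < n.+1%:R^-1.
    have /rat_in_itvoo[p] : a - n.+1%:R^-1 < a + n.+1%:R^-1.
      by rewrite ltrD2l gtrN.
    rewrite in_itv/= => /andP[p1 p2]; exists p.
    by rewrite ltr_distl p1 p2.
  have [p px] := rat_near x; have [q qy] := rat_near y.
  exists (p, q, n); last by split; rewrite -ball_normE.
  move=> [a b] [/=]; rewrite -!ball_normE /ball_/= => pa qb; apply: eU.
  split; rewrite -ball_normE/=.
    apply: le_lt_trans (ler_distD (ratr p) x a) _.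
    by rewrite [`|x - ratr p|]distrC (splitr e) ltrD// (lt_trans _ ne).
  apply: le_lt_trans (ler_distD (ratr q) y b) _.
  by rewrite [`|y - ratr q|]distrC (splitr e) ltrD// (lt_trans _ ne).
have -> : \bigcup_(q in [set q | B q `<=` U]) B q =
    \bigcup_q (if `[< B q `<=` U >] then B q else set0).
  apply/seteqP; split => [z [q /= qU Bqz]|z [q _]].
    by exists q => //; case: asboolP.
  by case: asboolP => // qU Bqz; exists q.
apply: countable_bigcupT_measurable; first exact: countableP.
move=> q; case: asboolP => // _.
by apply: measurableX; exact: measurable_ball.
Unshelve. all: by end_near. Qed.

Lemma continuous_measurable_plane (G : R * R -> R) : continuous G ->
  measurable_fun [set: T * T] (G : T * T -> T).
Proof.
move=> /continuousP cG.
apply: (measurability _ (RGenOpens.measurableE R)).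
move=> _ [_ [a [b ->] <-]]; rewrite setTI; apply: open_measurable_plane.
exact/cG/interval_open.
Qed.

Lemma plane_bounded_csupp_integrable (F : T * T -> T) (L B : R) :
  measurable_fun setT F -> (forall z, `|F z| <= B) ->
  (forall x y, L < `|x| \/ L < `|y| -> F (x, y) = 0) ->
  (mu \x mu)%E.-integrable setT (EFin \o F).
Proof.
move=> mF FB F0.
pose A : set (T * T) := `[- L, L] `*` `[- L, L].
have mA : measurable A by apply: measurableX; exact: measurable_itv.
have : (mu \x mu)%E.-integrable A (EFin \o F).
  apply: measurable_bounded_integrable => //.
  - rewrite [ltLHS](product_measure1E mu mu)//= lebesgue_measure_itv/=.
    by case: ifPn => // _; rewrite -?EFinD -?EFinM ?mule0 ?ltry//.
  - exact: measurable_funTS.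
  - exists B; split => [|M BM z _]; first exact: num_real.
    by rewrite /= (le_trans (FB z))// ltW.
rewrite integrable_mkcond//= (restrict_EFin F) => iF.
suff -> : F = F \_ A by [].
apply/funext => -[x y]; rewrite patchE.
case: ifPn => // /negP xA.
rewrite F0//; apply/orP; rewrite !ltNge !ler_norml -negb_and.
by apply/negP => /andP[xL yL]; apply: xA; rewrite inE; split; rewrite /= in_itv.
Qed.

Section Fubini.
Variables (G : R * R -> R) (r : R).
Hypothesis cG : continuous G.
Hypothesis G0 : forall p t, r <= `|p| \/ r <= `|t| -> G (p, t) = 0.

Let phi p : R := \int[mu]_t G (p, t).

Let cGcomp (f g : R -> R) : continuous f -> continuous g ->
  continuous (fun x => G (f x, g x)).
Proof.
move=> cf cg x.
apply: (@continuous2_cvg _ _ _ _ (nbhs x) _ f g (fun p t => G (p, t))).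
- rewrite (_ : (fun z => G (z.1, z.2)) = G); first exact: cG.
  by apply/funext => -[].
- exact: cf.
- exact: cg.
Qed.

Let caffine (p k : R) : continuous (fun x : R => p + x * k).
Proof.
move=> x; apply: cvgD; first exact: cvg_cst.
by apply: cvgM; [exact: cvg_id|exact: cvg_cst].
Qed.

Lemma csupp_plane_bounded : exists B, forall z, `|G z| <= B.
Proof.
have [M [_ MG]] : bounded_set (G @` (`[- r, r] `*` `[- r, r])).
  apply: compact_bounded; apply: continuous_compact.
    exact: continuous_subspaceT.
  by apply: compact_setX; exact: segment_compact.
exists (Num.max 0 (M + 1)) => -[p t].
have [pr|pr] := leP r `|p|; first by rewrite G0 ?normr0 ?le_max ?lexx//; left.
have [tr|tr] := leP r `|t|; first by rewrite G0 ?normr0 ?le_max ?lexx//; right.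
rewrite le_max; apply/orP; right; apply: MG; first by rewrite ltrDl.
by exists (p, t) => //; split; rewrite /= in_itv/= -ler_norml ltW.
Qed.

Let csection p : continuous (fun t => G (p, t)).
Proof. by apply: cGcomp => x; [exact: cvg_cst|exact: cvg_id]. Qed.

Lemma slice_integral_eq0 p : r <= `|p| -> phi p = 0.
Proof.
move=> rp; rewrite /phi (@eq_Rintegral _ _ _ mu _ (cst 0)); last first.
  by move=> t _; rewrite G0//; left.
by rewrite /Rintegral integral0.
Qed.

(** All slices are supported in one segment and bounded by one constant, so
    dominated convergence applies. *)
Lemma slice_integral_continuous : continuous phi.
Proof.
have [B GB] := csupp_plane_bounded.
have phiE p : phi p = \int[mu]_(t in `[- r, r]) G (p, t).
  rewrite [RHS]Rintegral_mkcond; congr Rintegral; apply/funext => t.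
  rewrite patchE mem_setE in_itv/= -ler_norml.
  by have [//|rt] := leP `|t| r; rewrite G0//; right; exact: ltW.
rewrite (_ : phi = fun p => \int[mu]_(t in `[- r, r]) G (p, t)); last first.
  by apply/funext.
move=> p.
apply: (@continuity_under_integral R _ _ mu (fun p t => G (p, t)) `[- r, r]
  (measurable_itv _) (p - 1) (p + 1) _ _ (cst B) _ _ p).
- move=> x _; apply: continuous_compact_integrable; first exact: segment_compact.
  exact: continuous_subspaceT.
- apply: nearW => t _ x _.
  by apply: (@cGcomp id (cst t)) => {}x; [exact: cvg_id|exact: cvg_cst].
- apply: continuous_compact_integrable; first exact: segment_compact.
  by apply: continuous_subspaceT => x; exact: cvg_cst.
- by move=> x _; apply: nearW => t _ /=.
- by rewrite inE/= in_itv/= ltrDl ltrBlDr ltrDl ltr01.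
Qed.

(** Parallel rays issue from the points of the vertical line of abscissa [s];
    the point of parameter [x] on the ray issued from [(s, t)] is
    [(s + x * k, t + x * b)].  That [k != 0] says that the rays are not parallel
    to the line of their origins, so that only a bounded set of [(t, x)]
    contributes. *)
Section oblique.
Variables (s k b : R).
Hypothesis k0 : k != 0.

Let F (z : T * T) : T :=
  if 0 <= z.2 then G (s + z.2 * k, z.1 + z.2 * b) else 0.

Let iF : (mu \x mu)%E.-integrable setT (EFin \o F).
Proof.
have [B GB] := csupp_plane_bounded.
(* If [F (t, x) != 0] then [`|s + x * k| < r] gives [`|x| <= L0], and then
   [`|t + x * b| < r] gives [`|t| <= `|r| + `|L0| * `|b|]; [L] exceeds both. *)
pose L0 := (r + `|s|) / `|k|; pose L := `|L0| + (`|r| + `|L0| * `|b|).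
have nk : 0 < `|k| by rewrite normr_gt0.
apply: (@plane_bounded_csupp_integrable _ L B).
- apply: measurable_fun_ifT => //=.
    apply: (measurable_fun_ler (f := cst 0) (g := snd)) => //.
  apply: (measurableT_comp (continuous_measurable_plane cG)).
  apply: measurable_fun_pair => /=; apply: measurable_funD => //;
  exact: measurable_funM.
- by move=> z; rewrite /F; case: ifP => // _; rewrite normr0 (le_trans _ (GB z)).
move=> t x; rewrite /F/= => Ltx; case: ifP => // _; apply: G0.
have [sr|] := leP r `|s + x * k|; [by left|move=> sr].
have [tr|] := leP r `|t + x * b|; [by right|move=> tr].
have xL0 : `|x| <= L0.
  rewrite ler_pdivlMr// -normrM -[x * k](addKr s).
  by rewrite (le_trans (ler_normD _ _))// normrN addrC lerD2r ltW.
have xL0' := le_trans xL0 (ler_norm L0).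
have tL : `|t| <= `|r| + `|L0| * `|b|.
  rewrite -[t](addrK (x * b)) (le_trans (ler_normD _ _))// normrN lerD//.
    by rewrite (le_trans (ltW tr))// ler_norm.
  by rewrite normrM ler_wpM2r.
have L00 : 0 <= `|L0| by [].
have rb0 : 0 <= `|r| + `|L0| * `|b| by rewrite addr_ge0// mulr_ge0.
rewrite /L in Ltx.
by exfalso; case: Ltx; rewrite ltNge => /negP; apply; lra.
Qed.

Let A t : R := \int[mu]_(x in `[0, +oo[) G (s + x * k, t + x * b).

(* Each ray integral is finite, so that taking its real part loses nothing. *)
Let AE : EFin \o A = fubini_F mu (EFin \o F).
Proof.
apply/funext => t /=; rewrite /fubini_F /A /Rintegral fineK; last first.
  apply: integrable_fin_num => //.
  apply: (@integrableS _ _ _ mu setT) => //.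
  apply: (@csupp_continuous_integrable _ (fun x => G (s + x * k, t + x * b))
    ((r + `|s|) / `|k|)) => [|x].
    by apply: cGcomp; exact: caffine.
  rewrite ler_pdivrMr ?normr_gt0// -normrM => rx; apply: G0; left.
  rewrite addrC -[s]opprK (le_trans _ (lerB_dist _ _))// normrN.
  by rewrite lerBrDr.
rewrite integral_mkcond; apply: eq_integral => x _.
by rewrite patchE mem_setE in_itv/= andbT /F/=; case: ifP.
Qed.

Lemma oblique_rays_integrable : mu.-integrable [set: R] (EFin \o A).
Proof. by rewrite AE; exact: integrable_fubini_F. Qed.

(** Integrating first over the origins [t], the shift by [x * b] disappears by
    translation invariance. *)
Lemma oblique_rays_integral :
  \int[mu]_t A t = \int[mu]_(x in `[0, +oo[) phi (s + x * k).
Proof.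
rewrite [RHS]Rintegral_mkcond /Rintegral.
have -> : (\int[mu]_t (A t)%:E = \int[mu]_t fubini_F mu (EFin \o F) t)%E.
  by rewrite -AE.
rewrite /fubini_F (Fubini iF); congr fine.
apply: eq_integral => x _.
rewrite patchE mem_setE in_itv/= andbT /F/=; case: ifP => x0; last first.
  by rewrite integral0.
rewrite /phi -(@integral_translation _ _ r (@csection (s + x * k)) _ (x * b)).
  rewrite /Rintegral fineK//; apply: integrable_fin_num => //.
  apply: (@csupp_continuous_integrable _ (fun t => G (s + x * k, t + x * b))
    (r + `|x * b|)) => [t|t rt].
    apply: (@cGcomp (cst _) (fun t => t + x * b)) => {}t; first exact: cvg_cst.
    by apply: cvgD; [exact: cvg_id|exact: cvg_cst].
  apply: G0; right; rewrite -[x * b]opprK (le_trans _ (lerB_dist _ _))// normrN.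
  by rewrite lerBrDr.
by move=> t rt; apply: G0; right.
Qed.

End oblique.
End Fubini.
End Plane.

(** * The Radon transform of a ray transform *)

Section RadonRay.
Context {R : realType}.
Notation mu := (@lebesgue_measure R).
Implicit Types (xi a : 'cV[R]_2) (s t x : R).

Lemma dotp2 (u v : 'cV[R]_2) : dotp u v = u 0 0 * v 0 0 + u 1 0 * v 1 0.
Proof.
rewrite /dotp !big_ord_recl big_ord0 addr0.
by rewrite (_ : lift ord0 ord0 = 1 :> 'I_2)//; exact/val_inj.
Qed.

Lemma unit_circleP xi : unit_circle xi -> xi 0 0 ^+ 2 + xi 1 0 ^+ 2 = 1.
Proof.
rewrite /unit_circle/= /enorm dotp2 -!expr2 => /(congr1 (fun y => y ^+ 2)).
by rewrite sqr_sqrtr ?expr1n// addr_ge0 ?sqr_ge0.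
Qed.

(** The coordinates of [a] in the orthonormal basis [xi, rot xi] are its dot
    products with the two basis vectors. *)
Lemma line_line_add xi a s t x : unit_circle xi ->
  line xi (s + x * dotp xi a) (t + x * dotp (Defs.rot xi) a) =
  line xi s t + x *: a.
Proof.
move=> /unit_circleP xi1.
have a0 : a 0 0 = a 0 0 * (xi 0 0 ^+ 2 + xi 1 0 ^+ 2) by rewrite xi1 mulr1.
have a1 : a 1 0 = a 1 0 * (xi 0 0 ^+ 2 + xi 1 0 ^+ 2) by rewrite xi1 mulr1.
apply/colP => i; rewrite !mxE !dotp2 !mxE/=.
have [->|->] : i = 0 \/ i = 1.
  by case: i => -[|[|//]] ?; [left|right]; exact/val_inj.
- by rewrite [in RHS]a0/=; ring.
- by rewrite [in RHS]a1/=; ring.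
Qed.

Lemma enorm_line xi s t : unit_circle xi ->
  enorm (line xi s t) = Num.sqrt (s ^+ 2 + t ^+ 2).
Proof.
move=> /unit_circleP xi1; rewrite /enorm; congr Num.sqrt.
by rewrite -[RHS]mulr1 -xi1 dotp2 !mxE/=; ring.
Qed.

Lemma continuous_line xi : continuous (fun z : R * R => line xi z.1 z.2).
Proof.
move=> z; apply: (@cvgD _ 'cV[R]_2).
  by apply: (@cvgZr_tmp R 'cV[R]_2 _ (nbhs z) _ fst z.1 xi); exact: cvg_fst.
by apply: (@cvgZr_tmp R 'cV[R]_2 _ (nbhs z) _ snd z.2); exact: cvg_snd.
Qed.

Section scalar.
Variables (r : R) (h : 'cV[R]_2 -> R).
Hypothesis ch : continuous h.
Hypothesis h0 : forall y, r <= enorm y -> h y = 0.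
Variable xi : 'cV[R]_2.
Hypothesis xi1 : unit_circle xi.

Let G (z : R * R) := h (line xi z.1 z.2).

Let cG : continuous G.
Proof.
by move=> z; apply: continuous_comp; [exact: continuous_line|exact: ch].
Qed.

Let G0 p t : r <= `|p| \/ r <= `|t| -> G (p, t) = 0.
Proof.
move=> rpt; apply: h0; rewrite enorm_line//.
case: rpt => rpt; apply: (le_trans rpt); rewrite -sqrtr_sqr ler_wsqrtr//.
  by rewrite lerDl sqr_ge0.
by rewrite lerDr sqr_ge0.
Qed.

Lemma radon_converges_csupp s : radon_converges h xi s.
Proof.
apply: (@csupp_continuous_integrable _ (fun t => h (line xi s t)) r) => [t|t rt].
  apply: (@continuous2_cvg _ _ _ _ (nbhs t) _ (cst s) id (fun p t => G (p, t))).
  - rewrite (_ : (fun z => G (z.1, z.2)) = G); first exact: cG.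
    by apply/funext => -[].
  - exact: cvg_cst.
  - exact: cvg_id.
by apply: (@G0 s t); right.
Qed.

Variable a : 'cV[R]_2.
Hypothesis axi : dotp xi a != 0.

Let rayE s t : ray_transform a h (line xi s t) =
  \int[mu]_(x in `[0, +oo[) G (s + x * dotp xi a, t + x * dotp (Defs.rot xi) a).
Proof. by apply: eq_Rintegral => x _; rewrite /G/= line_line_add. Qed.

Lemma radon_ray_converges s : radon_converges (ray_transform a h) xi s.
Proof.
rewrite /radon_converges; under eq_fun do rewrite rayE.
exact: (oblique_rays_integrable cG G0 s (dotp (Defs.rot xi) a) axi).
Qed.

(** The Radon transform of the ray transform is [(K - U s) / k], where [U] is a
    primitive of the Radon transform of [h] and [k] is [dotp xi a]. *)
Lemma is_derive_radon_ray s :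
  is_derive s 1 (radon (ray_transform a h) xi) (- (radon h xi s / dotp xi a)).
Proof.
have cphi := slice_integral_continuous cG G0.
have phi0 := slice_integral_eq0 G0.
have -> : radon (ray_transform a h) xi = fun s =>
  ((if 0 < dotp xi a then \int[mu]_p radon h xi p else 0) -
    primitive (radon h xi) s) / dotp xi a.
  apply/funext => p; rewrite /radon.
  under eq_Rintegral do rewrite rayE.
  rewrite (oblique_rays_integral cG G0)//.
  by rewrite (integral_halfline_comp cphi phi0).
have dU := is_derive_primitive cphi phi0 s.
under [X in is_derive _ _ X]eq_fun do rewrite mulrC.
by apply: is_derive_eq; rewrite add0r mul1r /GRing.scale/= mulrN mulrC.
Qed.
End scalar.

Lemma radon_lincomb (I : Type) (l : seq I) (c : I -> R)
    (H : I -> 'cV[R]_2 -> R) xi s :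
  (forall i, radon_converges (H i) xi s) ->
  radon_converges (fun y => \sum_(i <- l) c i * H i y) xi s /\
  radon (fun y => \sum_(i <- l) c i * H i y) xi s =
    \sum_(i <- l) c i * radon (H i) xi s.
Proof.
move=> iH; rewrite /radon_converges /radon.
have icH i : mu.-integrable setT (EFin \o (fun t => c i * H i (line xi s t))).
  exact: (integrableZl measurableT (c i) (iH i)).
have il (l' : seq I) : mu.-integrable [set: R]
    (EFin \o fun t => \sum_(i <- l') c i * H i (line xi s t)).
  rewrite (_ : EFin \o _ =
      (fun t => \sum_(i <- l') (c i * H i (line xi s t))%:E)%E); last first.
    by apply/funext => t; rewrite /= sumEFin.
  by apply: integrable_sum => // i _; exact: icH.
split; first exact: il.
elim: l => [|i l ih].
  under eq_Rintegral do rewrite big_nil.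
  by rewrite big_nil /Rintegral integral0.
under eq_Rintegral do rewrite big_cons.
rewrite big_cons (RintegralD measurableT (icH i) (il l)) ih; congr (_ + _).
exact: (@RintegralZl _ _ _ mu setT (fun t => H i (line xi s t)) _ measurableT
  (iH i)).
Qed.

End RadonRay.

(** * The matrix of the star transform *)

Lemma ord3P (P : 'I_3 -> Prop) : P 0 -> P 1 -> P ord_max -> forall k, P k.
Proof.
move=> P0 P1 P2 [[|[|[|//]]] k3].
- by rewrite (_ : Ordinal k3 = 0)//; exact/val_inj.
- by rewrite (_ : Ordinal k3 = 1)//; exact/val_inj.
- by rewrite (_ : Ordinal k3 = ord_max)//; exact/val_inj.
Qed.

Lemma det_mx33 (R : comNzRingType) (A : 'M[R]_3) : \det A =
  A 0 0 * (A 1 1 * A ord_max ord_max - A 1 ord_max * A ord_max 1)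
  - A 0 1 * (A 1 0 * A ord_max ord_max - A 1 ord_max * A ord_max 0)
  + A 0 ord_max * (A 1 0 * A ord_max 1 - A 1 1 * A ord_max 0).
Proof.
rewrite (expand_det_row _ 0) !big_ord_recl big_ord0 /cofactor.
rewrite !(expand_det_row _ 0) !big_ord_recl !big_ord0 /cofactor !det_mx11 !mxE.
pose a i j := A (inord i) (inord j).
have aE i j : A i j = a i j by rewrite /a !inord_val.
by rewrite !aE /= /bump/=; ring.
Qed.

Section Star.
Context {R : realType}.
Variables (m : nat) (gamma : 'I_m -> 'cV[R]_2) (c : 'I_m -> R) (xi : 'cV[R]_2).

(** The three tensors that a branch of direction [a] contributes to the rows of
    [Q] are also those against which the three components of the star transform
    test the field; indexing them by the same [k] lets the two be compared
    componentwise. *)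
Definition branch_row (a : 'cV[R]_2) (k : nat) : 'cV[R]_3 :=
  [:: sq a; odot_rot a; sq_rot a]`_k.

Lemma vec3_dotpE (u : 'cV[R]_3) a (k : 'I_3) :
  vec3 (dotp u (sq a)) (dotp u (odot_rot a)) (dotp u (sq_rot a)) k 0 =
  dotp u (branch_row a k).
Proof. by rewrite mxE; move: k; apply: ord3P. Qed.

Lemma Qmx_entry (k j : 'I_3) : Qmx gamma c xi k j =
  - \sum_(i < m) c i / dotp xi (gamma i) * branch_row (gamma i) k j 0.
Proof.
rewrite !mxE; move: k; apply: ord3P => /=; rewrite mxE summxE; congr (- _);
by apply: eq_bigr => i _; rewrite mxE.
Qed.

Lemma Qmx_mulE (V : 'cV[R]_3) (k : 'I_3) :
  (Qmx gamma c xi *m V) k 0 =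
  - \sum_(i < m) c i / dotp xi (gamma i) * dotp V (branch_row (gamma i) k).
Proof.
rewrite mxE; under eq_bigr do rewrite Qmx_entry mulNr mulr_suml.
rewrite sumrN exchange_big/=; congr (- _); apply: eq_bigr => i _.
rewrite /dotp mulr_sumr; apply: eq_bigr => j _.
by rewrite -[LHS]mulrA [V _ _ * _]mulrC.
Qed.

Let wsum (q : 'I_m -> R) := - \sum_(i < m) c i / dotp xi (gamma i) * q i.
Let X := wsum (fun i => gamma i 0 0 ^+ 2).
Let Y := wsum (fun i => gamma i 1 0 ^+ 2).
Let P := wsum (fun i => gamma i 0 0 * gamma i 1 0).

Let wsumN q : wsum (fun i => - q i) = - wsum q.
Proof. by rewrite /wsum; under eq_bigr do rewrite mulrN; rewrite sumrN. Qed.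

Let wsumB q1 q2 :
  wsum (fun i => 2^-1 * (q1 i - q2 i)) = 2^-1 * (wsum q1 - wsum q2).
Proof.
rewrite /wsum; under eq_bigr do rewrite mulrCA mulrBr.
by rewrite -mulr_sumr sumrB; ring.
Qed.

Let entryE (k j : 'I_3) q : (forall i, branch_row (gamma i) k j 0 = q i) ->
  Qmx gamma c xi k j = wsum q.
Proof.
by move=> kq; rewrite Qmx_entry; under eq_bigr do rewrite kq.
Qed.

Let br1 i : branch_row (gamma i) (1%R : 'I_3) = odot_rot (gamma i).
Proof. by []. Qed.

Let E10 : Qmx gamma c xi 1 0 = - P.
Proof. by rewrite -wsumN; apply: entryE => i; rewrite br1 odot_rotE mxE. Qed.

Let E11 : Qmx gamma c xi 1 1 = 2^-1 * (X - Y).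
Proof. by rewrite -wsumB; apply: entryE => i; rewrite br1 odot_rotE mxE. Qed.

Let E12 : Qmx gamma c xi 1 ord_max = P.
Proof. by apply: entryE => i; rewrite br1 odot_rotE mxE. Qed.

(** The rows are [(X, P, Y)], [(- P, (X - Y) / 2, P)] and [(Y, - P, X)], where
    [X], [P], [Y] are minus the weighted sums of the entries of the tensors
    [gamma_i ^ 2]. *)
Lemma det_Qmx : \det (Qmx gamma c xi) =
  2 * (X + Y) * (P ^+ 2 + (2^-1 * (X - Y)) ^+ 2).
Proof.
rewrite det_mx33.
have br0 i : branch_row (gamma i) (0%R : 'I_3) = sq (gamma i) by [].
have br2 i : branch_row (gamma i) (ord_max : 'I_3) = sq_rot (gamma i) by [].
have E00 : Qmx gamma c xi 0 0 = X by apply: entryE => i; rewrite br0 sqE mxE.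
have E01 : Qmx gamma c xi 0 1 = P by apply: entryE => i; rewrite br0 sqE mxE.
have E02 : Qmx gamma c xi 0 ord_max = Y.
  by apply: entryE => i; rewrite br0 sqE mxE.
have E20 : Qmx gamma c xi ord_max 0 = Y.
  by apply: entryE => i; rewrite br2 sq_rotE mxE.
have E21 : Qmx gamma c xi ord_max 1 = - P.
  by rewrite -wsumN; apply: entryE => i; rewrite br2 sq_rotE mxE.
have E22 : Qmx gamma c xi ord_max ord_max = X.
  by apply: entryE => i; rewrite br2 sq_rotE mxE.
by rewrite E00 E01 E02 E10 E11 E12 E20 E21 E22; field.
Qed.

(** For unit directions [X + Y] is minus the sum of the [c_i / (xi . gamma_i)],
    and the other factor of the determinant is the sum of the squares of two
    numbers that determine [gamma_dag]. *)
Lemma Qmx_unit : (forall i, unit_circle (gamma i)) ->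
  gamma_dag gamma c xi != 0 -> \sum_(i < m) c i / dotp xi (gamma i) != 0 ->
  Qmx gamma c xi \in unitmx.
Proof.
move=> gamma1 dag0 c0; rewrite unitmxE unitfE det_Qmx.
have XY : X + Y = - \sum_(i < m) c i / dotp xi (gamma i).
  rewrite /X /Y /wsum -opprD -big_split/=; congr (- _); apply: eq_bigr => i _.
  by rewrite -mulrDr unit_circleP// mulr1.
rewrite mulf_neq0//; first by rewrite XY mulf_neq0// ?oppr_eq0// pnatr_eq0.
apply: contra dag0; rewrite paddr_eq0 ?sqr_ge0// !sqrf_eq0.
move=> /andP[/eqP P0 /eqP D0].
have dagE k : gamma_dag gamma c xi k 0 = Qmx gamma c xi 1 k by rewrite !mxE.
apply/eqP/colP => k; rewrite dagE [RHS]mxE; move: k; apply: ord3P.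
- by rewrite E10 P0 oppr0.
- by rewrite E11 D0.
- by rewrite E12.
Qed.
End Star.

(** * The star transform of a tensor field *)

Section TensorField.
Context {R : realType} (r : R) (f : 'cV[R]_2 -> 'M[R]_2).
Hypothesis f_C2c : C2c_sym r f.

Lemma C2c_vanish y : r <= enorm y -> f y = 0.
Proof.
case: f_C2c => _ _ _ supp; apply: contraPeq => fy0.
by apply/negP; rewrite -ltNge; apply: supp; exact: subset_closure.
Qed.

Lemma tvec_continuous (j : 'I_3) : continuous (fun y => tvec (f y) j 0).
Proof.
case: f_C2c => _ Cf _ _.
have cf i k : continuous (fun y => f y i k) by case: (Cf i k).
rewrite (_ : (fun y => _) = fun y => [:: f y 0 0; f y 0 1; f y 1 1]`_j).
  by move: j; apply: ord3P; exact: cf.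
by apply/funext => y; rewrite mxE.
Qed.

Lemma tvec_vanish (j : 'I_3) y : r <= enorm y -> tvec (f y) j 0 = 0.
Proof.
by move=> /C2c_vanish ->; rewrite mxE; move: j; apply: ord3P; rewrite /= mxE.
Qed.

Lemma dotp_tvecE (w : 'cV[R]_3) : (fun y => dotp (tvec (f y)) w) =
  fun y => \sum_(j < 3) w j 0 * tvec (f y) j 0.
Proof. by apply/funext => y; apply: eq_bigr => j _; rewrite mulrC. Qed.

Lemma dotp_tvec_continuous (w : 'cV[R]_3) :
  continuous (fun y => dotp (tvec (f y)) w).
Proof.
rewrite dotp_tvecE => y.
rewrite [X in continuous_at _ X](_ : _ =
    \sum_(j < 3) (fun y => w j 0 * tvec (f y) j 0)); last first.
  by apply/funext => z; rewrite fct_sumE.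
elim/big_ind : _ => [|g1 g2|j _].
- exact: (@cst_continuous _ _ 0).
- by move=> cg1 cg2; exact: (@cvgD _ R^o _ (nbhs y) _ g1 g2 (g1 y) (g2 y)).
- apply: (@cvgM R _ (nbhs y)); first exact: (@cst_continuous _ _ (w j 0)).
  exact: tvec_continuous.
Qed.

Lemma dotp_tvec_vanish (w : 'cV[R]_3) y :
  r <= enorm y -> dotp (tvec (f y)) w = 0.
Proof.
by move=> ry; rewrite /dotp big1// => j _; rewrite tvec_vanish// mul0r.
Qed.

Lemma radon_dotp_tvec (w : 'cV[R]_3) xi s : unit_circle xi ->
  radon (fun y => dotp (tvec (f y)) w) xi s =
  dotp (vradon (fun y => tvec (f y)) xi s) w.
Proof.
move=> xi1; rewrite dotp_tvecE.
have cv j : radon_converges (fun y => tvec (f y) j 0) xi s.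
  exact: (radon_converges_csupp (@tvec_continuous j) (@tvec_vanish j) xi1).
have [_ ->] := radon_lincomb (index_enum 'I_3) (fun j => w j 0) cv.
by apply: eq_bigr => j _; rewrite mulrC mxE.
Qed.

End TensorField.

Section Main.
Context {R : realType} (r : R) (m : nat).
Variables (gamma : 'I_m -> 'cV[R]_2) (c : 'I_m -> R) (f : 'cV[R]_2 -> 'M[R]_2).

Lemma star_entry (k : 'I_3) : (fun x => star gamma c f x k 0) = fun x =>
  \sum_(i < m) c i * ray_transform (gamma i)
    (fun y => dotp (tvec (f y)) (branch_row (gamma i) k)) x.
Proof.
apply/funext => x; rewrite summxE; apply: eq_bigr => i _; rewrite !mxE.
by congr (_ * ray_transform _ _ _); apply/funext => y; exact: vec3_dotpE.
Qed.

Hypothesis f_C2c : C2c_sym r f.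
Variable xi : 'cV[R]_2.
Hypothesis xi1 : unit_circle xi.
Hypothesis gxi : forall i, dotp xi (gamma i) != 0.

Let h (k : 'I_3) i y := dotp (tvec (f y)) (branch_row (gamma i) k).

Let cv k i s : radon_converges (ray_transform (gamma i) (h k i)) xi s.
Proof.
exact: (radon_ray_converges (@dotp_tvec_continuous _ _ _ f_C2c _)
  (@dotp_tvec_vanish _ _ _ f_C2c _) xi1 (gxi i)).
Qed.

Lemma star_converges (k : 'I_3) s :
  radon_converges (fun x => star gamma c f x k 0) xi s.
Proof.
by rewrite star_entry; exact: (radon_lincomb (index_enum 'I_m) c (cv k ^~ s)).1.
Qed.

(** Branch [i] contributes [- c_i / (xi . gamma_i)] times the pairing of the
    Radon transform of the field with [branch_row (gamma i) k], and [Qmx_mulE]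
    recognizes the sum. *)
Lemma is_derive_radon_star (k : 'I_3) (s : R) :
  is_derive s 1 (fun s => vradon (star gamma c f) xi s k 0)
    ((Qmx gamma c xi *m vradon (fun x => tvec (f x)) xi s) k 0).
Proof.
rewrite (_ : (fun s => _) =
    \sum_(i < m) (fun s => c i * radon (ray_transform (gamma i) (h k i)) xi s)).
  have dray i := is_derive_radon_ray
    (@dotp_tvec_continuous _ _ _ f_C2c (branch_row (gamma i) k))
    (@dotp_tvec_vanish _ _ _ f_C2c _) xi1 (gxi i) s.
  rewrite Qmx_mulE -sumrN; apply: is_derive_sum => i.
  have := @is_deriveZ _ _ _ _ (c i) s 1 _ (dray i).
  move/is_derive_eq; apply.
  by rewrite (radon_dotp_tvec f_C2c)// /GRing.scale/= mulrN mulrA mulrAC.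
apply/funext => t; rewrite mxE star_entry fct_sumE.
exact: (radon_lincomb (index_enum 'I_m) c (cv k ^~ t)).2.
Qed.

End Main.

Theorem theorem11 (R : realType) (r : R) (m : nat)
  (gamma : 'I_m -> 'cV[R]_2) (c : 'I_m -> R) (f : 'cV[R]_2 -> 'M[R]_2)
  (r_gt0 : 0 < r)
  (gamma_unit : forall i, unit_circle (gamma i))
  (gamma_inj : injective gamma)
  (c_neq0 : forall i, c i != 0)
  (f_C2c : C2c_sym r f)
  (xi : 'cV[R]_2) (xiP : (unit_circle `\` (Z1 gamma `|` Z2 gamma c)) xi)
  (s : R) :
  [/\ forall (k : 'I_3) (s' : R),
        radon_converges (fun x => star gamma c f x k 0) xi s',
      derivable (fun s' : R => vradon (star gamma c f) xi s') s 1,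
      Qmx gamma c xi \in unitmx &
      invmx (Qmx gamma c xi) *m
        derive1 (fun s' : R => vradon (star gamma c f) xi s') s =
        vradon (fun x => tvec (f x)) xi s].
Proof.
case: xiP => xi1 /not_orP[nZ1 nZ2].
have gxi i : dotp xi (gamma i) != 0.
  by apply/eqP => gi0; apply: nZ1; exists i.
have Qu : Qmx gamma c xi \in unitmx.
  by apply: Qmx_unit => //; apply/eqP => z; apply: nZ2; [left|right].
have dQ (k : 'I_3) := is_derive_radon_star c f_C2c xi1 gxi k s.
have der : derivable (fun s' => vradon (star gamma c f) xi s') s 1.
  apply/derivable_mxP => k j; rewrite (ord1 j).
  exact: (@ex_derive _ _ _ _ _ _ _ (dQ k)).
split => //; first by move=> k s'; exact: (star_converges _ f_C2c).
rewrite derive1E derive_mx//.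
rewrite (_ : \matrix_(i, j) _ =
    Qmx gamma c xi *m vradon (fun x => tvec (f x)) xi s).
  by rewrite mulKmx.
apply/matrixP => k j; rewrite mxE (ord1 j).
exact: (@derive_val _ _ _ _ _ _ _ (dQ k)).
Qed.
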